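(* Let $G$ be an extraspecial $2$-group of order $2^{2n+1}$ with center $Z=\{1,z\}$. Let $T$ be a partial $k$-spread in $\mathbb{F}_2^{2n}$ with $N$ elements, and assume that the points of $T$ span $\mathbb{F}_2^{2n}$. Let $X=\mathrm{Cay}(G,S)$ with $S=K(x_1)\cup\cdots\cup K(x_\ell)$ (a union of distinct conjugacy classes of noncentral elements, so $z\notin S$) such that the image $\bar S=\{\bar x_1,\dots,\bar x_\ell\}$ of $S$ in $G/Z\cong\mathbb{F}_2^{2n}$ is the set of points incident to the elements of $T$. If $\nu_2(N)\le k-2$, then $X$ is a connected graph which admits balanced fractional revival. In particular, when $T$ is a partial $n$-spread with $n\ge3$ and $N=2^{n-2}$, then $X$ is a connected graph which admits balanced fractional revival.
   Context: An extraspecial $2$-group is a finite $2$-group $G$ whose center $Z$ has order $2$ and such that $G/Z\cong(\mathbb{Z}/2\mathbb{Z})^m$ for some $m\ge1$; its order is $2^{2n+1}$ for some $n\ge1$. Fix an isomorphism $G/Z\cong\mathbb{F}_2^{2n}$ and write $\bar g$ for the image of $g\in G$. The conjugacy class of a noncentral $x$ is $K(x)=\{x,xz\}$. A partial $k$-spread in $\mathbb{F}_2^{2n}$ is a set of $k$-dimensional subspaces any two of which intersect in the zero subspace. The points incident to the elements of $T$ (the points of $T$) are the nonzero vectors lying in some element of $T$. $\mathrm{Cay}(G,S)$ is the graph with vertex set $G$ in which $g,h$ are adjacent iff $gh^{-1}\in S$. For a graph with adjacency matrix $A$, $U_A(t)=\sum_{k\ge0}\frac{(it)^k}{k!}A^k$.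 The graph admits fractional revival at time $\tau>0$ if there are distinct vertices $u,v$ and $a,b\in\mathbb{C}$ with $|a|^2+|b|^2=1$, $b\ne0$ and $U_A(\tau)e_u=ae_u+be_v$; it is balanced if $|a|=|b|=1/\sqrt2$. A graph admits balanced fractional revival if this occurs at some time $\tau>0$. $\nu_2$ is the $2$-adic valuation. *)

(* Defs.v *)
From HB Require Import structures.
From mathcomp Require Import all_boot all_order all_fingroup all_algebra.
From mathcomp Require Import all_solvable mxabelem.
From mathcomp Require Import finmap complex.
From mathcomp Require Import all_classical all_reals all_analysis.

Set Implicit Arguments.
Unset Strict Implicit.
Unset Printing Implicit Defensive.

Import Order.TTheory GRing.Theory Num.Theory.
Import numFieldNormedType.Exports.
Local Open Scope ring_scope.

(* MathComp's [extraspecial] asks that 'Phi(G) = G^`(1) = 'Z(G) with 'Z(G) of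
   prime order. For a 2-group this says that the center has order 2 and that
   G / 'Z(G) is a nontrivial elementary abelian group. *)
Lemma extraspecial_2groupE (gT : finGroupType) (G : {group gT}) :
  (2.-group G)%g ->
  extraspecial G <->
  #|'Z(G)%g| = 2%N /\
  exists m : nat, (0 < m)%N /\ (G / 'Z(G) \isog [set: 'rV['F_2]_m])%g.
Proof.
move=> pG; split.
  move=> esG; have [[ePhi eG'] prZ] := esG.
  have ZG : #|'Z(G)%g| = 2%N by apply: card_center_extraspecial pG esG.
  split=> //.
  have abE : (2.-abelem (G / 'Z(G)))%g by rewrite -ePhi; apply: Phi_quotient_abelem.
  have [k ck] : exists k, #|(G / 'Z(G))%g| = (2 ^ k)%N.
    by have [k ck] := p_natP (abelem_pgroup abE); exists k.
  exists k; split.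
    rewrite lt0n; apply/eqP=> k0; move/eqP: ck; rewrite k0 expn0.
    rewrite -trivg_card1 -subG1 quotient_sub1 ?(normal_norm (center_normal G)) //.
    rewrite finset.subsetI subxx /= => abG.
    by move: prZ; rewrite -eG' (derG1P abG) cards1.
  rewrite (isog_abelem_card _ abE) mx_Fp_abelem //=.
  by rewrite cardsT card_mx mul1n card_Fp // ck.
move=> [ZG [m [m0 isoZ]]].
have abE : (2.-abelem (G / 'Z(G)))%g.
  by rewrite (isog_abelem isoZ) mx_Fp_abelem.
have sPZ : ('Phi(G) \subset 'Z(G))%g.
  by apply: Phi_min pG (normal_norm (center_normal G)) abE.
have sG'P : (G^`(1) \subset 'Phi(G))%g.
  by rewrite (Phi_joing pG) joing_subl.
have G'n1 : (G^`(1) != 1)%g.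
  apply/eqP=> /derG1P abG.
  have := card_isog isoZ; rewrite -[gval (G / _)%G]/(G / 'Z(G))%g.
  have /eqP -> : (G / 'Z(G) == 1)%g.
    rewrite -subG1 quotient_sub1 ?(normal_norm (center_normal G)) //.
    by rewrite finset.subsetI subxx.
  rewrite cards1 cardsT card_mx mul1n card_Fp // => /esym/eqP.
  by rewrite -(expn0 2) eqn_exp2l // -leqn0 leqNgt m0.
have eG'Z : (G^`(1) = 'Z(G))%g.
  apply/eqP; rewrite eqEcard (fintype.subset_trans sG'P sPZ) ZG.
  by rewrite cardG_gt1.
split; last by rewrite ZG.
split=> //; apply/eqP; rewrite finset.eqEsubset sPZ /= -eG'Z //.
Qed.

Definition partial_spread (m k : nat) (T : {fset {vspace 'rV['F_2]_m}}) :
    Prop :=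
  (forall U : {vspace 'rV['F_2]_m}, U \in T -> \dim U = k) /\
  (forall U W : {vspace 'rV['F_2]_m},
     U \in T -> W \in T -> U != W -> (U :&: W = 0)%VS).

Definition points (m : nat) (T : {fset {vspace 'rV['F_2]_m}}) :
    {set 'rV['F_2]_m} :=
  [set v : 'rV['F_2]_m |
    (v != 0) && has (fun U : {vspace 'rV['F_2]_m} => v \in U) T].

Definition cayley (gT : finGroupType) (S : {set gT}) : rel gT :=
  fun g h => (g * h^-1)%g \in S.

Definition connected_graph (V : finType) (e : rel V) : Prop :=
  forall u v : V, connect e u v.

Definition adjmx (K : pzSemiRingType) (V : finType) (e : rel V) : 'M[K]_#|V| :=
  \matrix_(i, j) (e (enum_val i) (enum_val j))%:R.

Definition evec (K : pzSemiRingType) (V : finType) (u : V) : 'cV[K]_#|V| :=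
  delta_mx (enum_rank u) 0.

(* The series is taken over an abstract numClosedFieldType because the topology
   of matrices is not inferred directly over the concrete type R[i]. [limn] is
   total; it is used here at K := R[i], where the exponential series converges. *)
Definition transition (K : numClosedFieldType) (n : nat) (A : 'M[K]_n) (t : K) :
    'M[K]_n :=
  limn (series (fun k : nat => (('i * t) ^+ k / (k`!)%:R) *: A ^+ k)).

Definition fractional_revival (R : realType) (V : finType) (e : rel V) (tau : R)
    (u v : V) (a b : R[i]) : Prop :=
  [/\ u != v, `|a| ^+ 2 + `|b| ^+ 2 = 1, b != 0
    & transition (adjmx R[i] e) tau%:C%C *m evec R[i] u =
        a *: evec R[i] u + b *: evec R[i] v].

Definition admits_balanced_revival (R : realType) (V : finType) (e : rel V) :
    Prop :=
  exists (tau : R) (u v : V) (a b : R[i]),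
    [/\ 0 < tau, fractional_revival e tau u v a b,
        `|a| = (Num.sqrt 2)^-1%:C%C & `|b| = (Num.sqrt 2)^-1%:C%C].

(* Main.v *)
(** For a subspace [U] of [G / Z] let [E_U] be the averaging idempotent of its
    preimage in [G], a normal subgroup of order [2 ^ (k + 1)] when [\dim U = k],
    and let [E_0] be that of [Z].  These idempotents commute, and the partial
    spread property reads [A = 2 ^ (k + 1) \sum_(U in T) E_U - 2 N E_0].  Since
    [exp (B + s E) = exp (B + s) E + exp B (1 - E)] for an idempotent [E]
    commuting with [B], at time [t = pi / 2 ^ (logn 2 N + 2)], for which
    [2 ^ (k + 1) t] is a multiple of [2 pi], every [E_U] contributes trivially
    and the transition matrix is [w E_0 + (1 - E_0)] with
    [w = exp (- 2 i N t) = +- i].  As [E_0 e_1 = (e_1 + e_z) / 2], this is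
    balanced revival from [1] to [z]. *)

Require Import Defs.
From HB Require Import structures.
From mathcomp Require Import all_boot all_order all_fingroup all_algebra.
From mathcomp Require Import all_solvable.
From mathcomp Require finfield.
From mathcomp Require Import ring.
From mathcomp Require Import finmap complex.
From mathcomp Require Import all_classical all_reals all_analysis.
Import Order.TTheory GRing.Theory Num.Theory.
Import numFieldNormedType.Exports.
Local Open Scope ring_scope.

Set Implicit Arguments.
Unset Strict Implicit.
Unset Printing Implicit Defensive.

(** * Powers of a ring element perturbed by a commuting idempotent *)

Section Idempotent.
Variables (R : pzRingType) (A s E : R).
Hypotheses (cAE : A * E = E * A) (csE : s * E = E * s).
Hypothesis idE : E * E = E.

(** Multiplied by [E], the sum [A + s * E] acts as [A + s]; multiplied by [1 - E], it acts as [A].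
    Commutation carries this through the powers. *)
Lemma expr_shift_idempotent k :
  (A + s * E) ^+ k = (A + s) ^+ k * E + A ^+ k * (1 - E).
Proof.
elim: k => [|k IH]; first by rewrite !expr0 !mul1r addrC subrK.
have nE : (1 - E) * E = 0 by rewrite mulrBl mul1r idE subrr.
have cD : E * (A + s * E) = (A + s) * E.
  by rewrite mulrDr mulrDl cAE mulrA -csE -mulrA idE.
have cN : (1 - E) * (A + s * E) = A * (1 - E).
  by rewrite mulrBl mul1r cD mulrDl opprD addrACA subrr addr0 mulrBr mulr1.
by rewrite exprSr IH mulrDl -!mulrA cD cN !mulrA -!exprSr.
Qed.

End Idempotent.

(** * The exponential series of matrices *)

Definition exp_series (K : numClosedFieldType) (n : nat) (c : K) (A : 'M[K]_n) :=
  series (fun k : nat => (c ^+ k / k`!%:R) *: A ^+ k).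

(** A limit relation, since over an abstract field the series need not converge; the values [w] come
    later from Euler's formula in [R[i]]. *)
Definition scalar_exp (K : numClosedFieldType) (c w : K) : Prop :=
  (series (fun k : nat => c ^+ k / k`!%:R) @ \oo --> w)%classic.

Section MatrixExponential.
Variables (K : numClosedFieldType) (n : nat).
Implicit Types (A E L : 'M[K]_n) (c s w : K).

Lemma cvg_mx (u : nat -> 'M[K]_n) L :
  (forall i j, (u m i j @[m --> \oo] --> L i j)%classic) ->
  (u @ \oo --> L)%classic.
Proof.
move=> uL; apply/cvg_mx_entourageP => P entP.
near=> m => i j; rewrite inE; move: i j; near: m.
(* There are finitely many entries, so their eventual bounds hold simultaneously. *)
suff : (\forall m \near \oo, forall ij : 'I_n * 'I_n,
   P (L ij.1 ij.2, u m ij.1 ij.2))%classic.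
  by apply: filterS => m h i j; exact: (h (i, j)).
apply: filter_forall => -[i j] /=.
by have /cvg_app_entourageP := uL i j; apply.
Unshelve. all: by end_near. Qed.

Lemma cvg_mulmxr (u : nat -> 'M[K]_n) L A :
  (u @ \oo --> L -> (u m *m A) @[m --> \oo] --> L *m A)%classic.
Proof.
move=> uL; apply: cvg_mx => i j; rewrite mxE.
under eq_fun do rewrite mxE.
apply: cvg_big => [|k _]; first exact: add_continuous.
apply: cvgMr_tmp.
exact: (cvg_comp _ (fun M : 'M[K]_n => M i k) uL (@coord_continuous _ _ _ i k L)).
Qed.

Lemma exp_series_scalar c s w :
  scalar_exp (c * s) w -> (exp_series c s%:M @ \oo --> (w%:M : 'M[K]_n))%classic.
Proof.
move=> cw; rewrite -(scalemx1 _ w).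
rewrite (_ : exp_series c s%:M = fun m =>
  series (fun k : nat => (c * s) ^+ k / k`!%:R) m *: (1%:M : 'M[K]_n)).
  by apply: cvgZr_tmp.
apply/funext => m; rewrite /exp_series /series /= scaler_suml.
apply: eq_bigr => k _; rewrite -rmorphXn /= -[(s ^+ k)%:M]scalemx1 scalerA exprMn.
by congr (_ *: _); rewrite mulrAC.
Qed.

Lemma exp_series_shift_idempotent c s A E (m : nat) :
  A *m E = E *m A -> E *m E = E ->
  exp_series c (A + s *: E) m =
    exp_series c (A + s%:M) m *m E + exp_series c A m *m (1%:M - E).
Proof.
move=> cAE idE; rewrite /exp_series /series /= !mulmx_suml -big_split /=.
apply: eq_bigr => k _; rewrite -!scalemxAl -scalerDr -[s *: E]mul_scalar_mx.
congr (_ *: _).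
apply: expr_shift_idempotent => //.
exact: esym (scalar_mxC s E).
Qed.

Lemma cvg_exp_series_shift c s A E L1 L2 :
  A *m E = E *m A -> E *m E = E ->
  (exp_series c (A + s%:M) @ \oo --> L1)%classic ->
  (exp_series c A @ \oo --> L2)%classic ->
  (exp_series c (A + s *: E) @ \oo --> L1 *m E + L2 *m (1%:M - E))%classic.
Proof.
move=> cAE idE h1 h2.
have -> : exp_series c (A + s *: E) = fun m =>
    exp_series c (A + s%:M) m *m E + exp_series c A m *m (1%:M - E).
  by apply/funext => m; exact: exp_series_shift_idempotent.
by apply: cvgD; apply: cvg_mulmxr.
Qed.

(* The case of interest is [exp (c * s) = 1]; quantifying over the shifts by
   multiples of [s] is what makes the induction on [r] go through. *)
Lemma cvg_exp_series_sum c s L A (I : Type) (r : seq I) (E : I -> 'M[K]_n) :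
  (forall i, E i *m E i = E i) ->
  (forall i j, E i *m E j = E j *m E i) ->
  (forall i, A *m E i = E i *m A) ->
  (forall j : nat, (exp_series c (A + (s *+ j)%:M) @ \oo --> L)%classic) ->
  forall j : nat,
    (exp_series c (A + \sum_(i <- r) s *: E i + (s *+ j)%:M) @ \oo --> L)%classic.
Proof.
move=> idE cE cAE AL; elim: r => [|i r IH] j; first by rewrite big_nil addr0.
rewrite big_cons; set B := \sum_(k <- r) _ in IH *.
have -> : A + (s *: E i + B) + (s *+ j)%:M = A + B + (s *+ j)%:M + s *: E i.
  rewrite (addrC (s *: E i)) addrA; exact: addrAC.
(* Both limits in the shift formula are [L]: the part along [1 - E i] keeps the shift [j], the part
   along [E i] raises it to [j.+1]. *)
have -> : L = L *m E i + L *m (1%:M - E i) by rewrite -mulmxDr addrC subrK mulmx1.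
have cBE : (A + B + (s *+ j)%:M) *m E i = E i *m (A + B + (s *+ j)%:M).
  rewrite !mulmxDl !mulmxDr cAE scalar_mxC; congr (_ + _ + _).
  rewrite mulmx_suml mulmx_sumr; apply: eq_bigr => k _.
  by rewrite -scalemxAl -scalemxAr cE.
have := cvg_exp_series_shift cBE (idE i) _ (IH j); apply.
rewrite -addrA -raddfD /= -mulrSr; exact: IH.
Qed.

Lemma transitionE (A L : 'M[K]_n) t :
  (exp_series ('i * t) A @ \oo --> L)%classic -> transition A t = L.
Proof. by move=> h; apply: cvg_lim h; exact: norm_hausdorff. Qed.

End MatrixExponential.

(** An epsilon form free of topology, so that over [R[i]] only norms have to be estimated. *)
Lemma scalar_expP (K : numClosedFieldType) (c w : K) :
  (forall e, 0 < e -> exists m0 : nat, forall m : nat, (m0 <= m)%N ->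
     `|w - series (fun k : nat => c ^+ k / k`!%:R) m| < e) ->
  scalar_exp c w.
Proof.
move=> h; apply/cvgrPdist_lt => e e0; have [m0 hm] := h e e0.
by exists m0.
Qed.

(** * Euler's formula in [R[i]] *)

Section Euler.
Variable R : realType.
Local Open Scope complex_scope.

(** Powers of the imaginary unit are real at even and purely imaginary at odd indices, where
    respectively [cos_coeff] and [sin_coeff] are supported. *)
Lemma series_exp_i (x : R) (m : nat) :
  series (fun k : nat => ('i * x%:C) ^+ k / k`!%:R) m =
  (series (cos_coeff x) m) +i* (series (sin_coeff x) m).
Proof.
elim: m => [|m IH]; first by rewrite /series /= !big_nil.
rewrite !seriesSr IH.
suff -> : ('i * x%:C) ^+ m / m`!%:R = cos_coeff x m +i* sin_coeff x m by [].
have -> : (m`!%:R : R[i]) = (m`!%:R : R)%:C by rewrite rmorph_nat.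
rewrite exprMn -rmorphXn /= -mulrA -fmorphV -rmorphM /= -complexiE.
(* The exponent [m.-1./2] is that of [sin_coeff]; it matters only for odd [m], where it equals
   [m./2]. *)
have -> : ('i ^+ m : R[i]) =
    ((~~ odd m)%:R * (-1) ^ m./2) +i* ((odd m)%:R * (-1) ^ m.-1./2).
  rewrite -[in LHS](odd_double_half m) exprD -muln2 mulnC exprM.
  have -> : 'i ^+ 2 = (-1 : R)%:C by rewrite sqr_i rmorphN1.
  rewrite -rmorphXn /=.
  have [om|om] := boolP (odd m) => /=.
    rewrite expr1 mul0r mul1r -[m in m.-1](odd_double_half m) om /= doubleK.
    by apply/eqP; rewrite eq_complex /=
      !(mulr0, mul0r, mulr1, mul1r, addr0, add0r, sub0r, oppr0) !eqxx.
  by rewrite [_ ^+ 0]expr0 !mul0r !mul1r.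
rewrite /cos_coeff /sin_coeff.
by apply/eqP; rewrite eq_complex /= !(mulr0, add0r, subr0) !mulrA !eqxx.
Qed.

Lemma scalar_exp_i (x : R) : scalar_exp ('i * x%:C) (cos x +i* sin x).
Proof.
apply: scalar_expP => e e0.
(* A positive element of [R[i]] has zero imaginary part. *)
have [e' e'0 ->] : exists2 e' : R, 0 < e' & e = e'%:C.
  by move: e0; case: e => a b; rewrite ltcE /= => /andP[/eqP /= -> a0]; exists a.
have hc : (series (cos_coeff x) @ \oo --> cos x)%classic.
  by rewrite cos.unlock; exact: is_cvg_series_cos_coeff.
have hs : (series (sin_coeff x) @ \oo --> sin x)%classic.
  by rewrite sin.unlock; exact: is_cvg_series_sin_coeff.
have e2 : 0 < e' / 2 by rewrite divr_gt0.
have [m1 _ h1] :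
    (\forall m \near \oo, `|cos x - series (cos_coeff x) m| < e' / 2)%classic.
  by move/cvgrPdist_lt: hc; apply.
have [m2 _ h2] :
    (\forall m \near \oo, `|sin x - series (sin_coeff x) m| < e' / 2)%classic.
  by move/cvgrPdist_lt: hs; apply.
exists (maxn m1 m2) => m; rewrite geq_max => /andP[le1 le2].
rewrite series_exp_i.
have {h1}h1 := h1 m le1; have {h2}h2 := h2 m le2.
rewrite normc_def /= ltcR.
set a := _ - series (cos_coeff x) m in h1 *; set b := _ - _ in h2 *.
(* The modulus is at most the sum of the absolute values of the real and imaginary parts, each below
   [e' / 2]. *)
apply: (@le_lt_trans _ _ (`|a| + `|b|)); last by rewrite [ltRHS](splitr e') ltrD.
rewrite -(ger0_norm (addr_ge0 (normr_ge0 a) (normr_ge0 b))) -(sqrtr_sqr (`|a| + `|b|)).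
rewrite ler_wsqrtr // -[a ^+ 2]real_normK ?num_real // -[b ^+ 2]real_normK ?num_real //.
by rewrite sqrrD addrAC lerDl mulrn_wge0 // mulr_ge0.
Qed.

End Euler.

(** * Cayley adjacency matrices and averaging idempotents *)

Section CayleyMatrices.
Variables (K : numFieldType) (gT : finGroupType).
Local Open Scope group_scope.

Lemma adjmx_cayleyM (S1 S2 : {set gT}) i j :
  (adjmx K (cayley S1) *m adjmx K (cayley S2))%R i j =
  (#|[set w | ((enum_val i * w^-1)%g \in S1) &&
      ((w * (enum_val j)^-1)%g \in S2)]%SET|%:R)%R.
Proof.
rewrite mxE (reindex (@enum_rank gT)) /=; last first.
  by exists enum_val => ? _; rewrite ?enum_rankK ?enum_valK.
under eq_bigr do rewrite !mxE enum_rankK -natrM mulnb /cayley.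
rewrite -natr_sum -big_mkcond sum1dep_card.
by congr (_%:R)%R; apply: eq_card => w; rewrite !inE.
Qed.

(** Replacing the middle vertex [w] of a two-step walk from [g] to [h] by [g * w^-1 * h] exchanges
    the two steps, up to a conjugation that normality of [H] absorbs. *)
Lemma adjmx_cayley_comm (S : {set gT}) (H : {group gT}) : [set: gT] \subset 'N(H) ->
  (adjmx K (cayley S) *m adjmx K (cayley H) =
   adjmx K (cayley H) *m adjmx K (cayley S))%R.
Proof.
move=> nH; have HJ a g : (a ^ g \in H) = (a \in H).
  by rewrite memJ_norm // (fintype.subsetP nH) ?inE.
apply/matrixP => i j; rewrite !adjmx_cayleyM.
set g := enum_val i; set h := enum_val j; congr (_%:R)%R.
have fI : injective (fun w => g * w^-1 * h).
  by move=> u v /mulIg /mulgI /invg_inj.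
rewrite -[RHS](card_preimset _ fI); apply: eq_card => w; rewrite !inE mulgK andbC.
rewrite (_ : g * (g * w^-1 * h)^-1 = (w * h^-1) ^ (h * g^-1)) ?HJ //.
by rewrite conjgE !invMg !invgK !mulgA mulgKV.
Qed.

(** If [g] and [h] share a right coset of [H], the middle vertices are exactly that coset; otherwise
    there are none. *)
Lemma adjmx_cayley_sqr (H : {group gT}) :
  (adjmx K (cayley H) *m adjmx K (cayley H) =
   #|H|%:R *: adjmx K (cayley H))%R.
Proof.
apply/matrixP => i j; rewrite adjmx_cayleyM !mxE /cayley.
set g := enum_val i; set h := enum_val j; rewrite -natrM; congr (_%:R)%R.
have [gh|gh] := boolP (g * h^-1 \in H); last first.
  rewrite muln0; apply/eqP; rewrite cards_eq0; apply/eqP/finset.setP => w; rewrite !inE.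
  apply: contraNF gh => /andP[gw wh].
  by rewrite -(mulgKV w g) -mulgA groupM.
rewrite muln1 -(card_rcoset H h); apply: eq_card => w.
rewrite !inE mem_rcoset andb_idl // => wh.
by rewrite -(mulgKV h g) -mulgA -[h * _]invgK invMg invgK groupMl ?groupV.
Qed.

(** Left multiplication by the mean of [H] in the group algebra. It is defined for sets so that it
    applies verbatim to [[set 1; z]]. *)
Definition avgmx (H : {set gT}) : 'M[K]_#|gT| :=
  (#|H|%:R^-1 *: adjmx K (cayley H))%R.

Lemma adjmx_avgmx (H : {group gT}) :
  (adjmx K (cayley H) = #|H|%:R *: avgmx H)%R.
Proof. by rewrite scalerA divff ?scale1r // pnatr_eq0 -lt0n cardG_gt0. Qed.

Lemma avgmx_idem (H : {group gT}) : (avgmx H *m avgmx H = avgmx H)%R.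
Proof.
rewrite /avgmx -scalemxAl -scalemxAr adjmx_cayley_sqr !scalerA.
by rewrite -mulrA mulVf ?mulr1 // pnatr_eq0 -lt0n cardG_gt0.
Qed.

Lemma avgmx_comm (S : {set gT}) (H : {group gT}) : [set: gT] \subset 'N(H) ->
  (avgmx S *m avgmx H = avgmx H *m avgmx S)%R.
Proof.
move=> nH; rewrite /avgmx -!scalemxAl -!scalemxAr adjmx_cayley_comm //.
by rewrite !scalerA mulrC.
Qed.

Lemma avgmx_evec1 (z : gT) : z != 1 ->
  (avgmx [set 1%g; z]%SET *m evec K 1%g = 2^-1 *: (evec K 1%g + evec K z))%R.
Proof.
move=> z1; rewrite /avgmx cards2 eq_sym z1 -scalemxAl; congr (_ *: _)%R.
rewrite /evec -colE; apply/colP => i; rewrite !mxE /= eqxx !andbT.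
rewrite /cayley enum_rankK invg1 mulg1 !inE -(inj_eq enum_val_inj).
rewrite -[i == enum_rank z](inj_eq enum_val_inj) !enum_rankK.
by case: eqVneq => [->|_]; [rewrite eq_sym (negPf z1) addr0 | rewrite add0r].
Qed.

Lemma connected_cayley (S : {set gT}) :
  <<S>> = [set: gT] -> connected_graph (cayley S).
Proof.
move=> genS u v.
(* In a finite group, generated elements are products of generators without inverses; peeling off
   the leftmost factor is one step of a walk. *)
have conS g : g \in <<S>> -> forall h, connect (cayley S) (g * h) h.
  move/gen_prodgP => [k [c cS ->]]; elim: k c cS => [|k IH] c cS h.
    by rewrite big_ord0 mul1g connect0.
  rewrite big_ord_recl -mulgA.
  apply: connect_trans (IH _ (fun i => cS (lift ord0 i)) h).
  by apply: connect1; rewrite /cayley mulgK.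
by rewrite -(mulgKV v u); apply: conS; rewrite genS inE.
Qed.

End CayleyMatrices.

(** * Incidence count in a partial spread *)

Section PartialSpread.
Variables (m k : nat) (T : {fset {vspace 'rV['F_2]_m}}).
Hypothesis spreadT : partial_spread k T.

(** Distinct elements of [T] meet only in zero, so a nonzero point is counted once, while the zero
    vector is counted by every element. *)
Lemma partial_spread_count (v : 'rV['F_2]_m) :
  (\sum_(U <- T) (v \in U) = (v \in points T) + #|` T| * (v == 0%R))%N.
Proof.
rewrite inE; have [->|v0] /= := eqVneq v 0.
  under eq_bigr do rewrite mem0v.
  by rewrite add0n muln1 big_const_seq count_predT iter_addn_0 mul1n.
rewrite muln0 addn0; case: hasP => [[U UT vU]|noU].
  rewrite (bigD1_seq U) ?fset_uniq //= vU big_seq_cond big1 ?addn0 //.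
  move=> W /andP[WT WU]; apply/eqP; rewrite eqb0; apply: contra v0 => vW.
  by rewrite -memv0 -(spreadT.2 U W) // 1?eq_sym // memv_cap vU.
rewrite big_seq big1 // => U UT; apply/eqP; rewrite eqb0.
by apply/negP => vU; apply: noU; exists U.
Qed.

End PartialSpread.

(** * Preimages of subspaces under the quotient by the center, and the transition matrix *)

Section VectorQuotient.
Variables (gT : finGroupType) (m : nat) (z : gT).
Local Notation V := 'rV['F_2]_m.
Variable f : {morphism [set: gT] >-> V}.
Hypothesis kerf : ('ker f = [set 1; z]%SET)%g.
Hypothesis imf : (f @* [set: gT] = [set: V])%g.

Lemma morph_mulg_add g h : f (g * h)%g = f g + f h.
Proof. by rewrite morphM ?inE. Qed.

Lemma morph_invg_opp g : f (g^-1)%g = - f g.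
Proof. by rewrite morphV ?inE. Qed.

Lemma morph_eq0 g : (f g == 0) = (g \in [set 1%g; z]%SET).
Proof. by rewrite -kerf; apply/eqP/kerP; rewrite ?inE. Qed.

Lemma morph_onto v : exists g, f g = v.
Proof.
have : v \in (f @* [set: gT])%g by rewrite imf inE.
by case/morphimP => g _ _ ->; exists g.
Qed.

Lemma preim_vspace_group_set (U : {vspace V}) :
  group_set [set g | f g \in U]%SET.
Proof.
apply/group_setP; split => [|g h]; first by rewrite inE morph1 mem0v.
by rewrite !inE morph_mulg_add; exact: rpredD.
Qed.

Definition preim_vspace U := Group (preim_vspace_group_set U).

Lemma card_preim_vspace U : z != 1%g -> #|preim_vspace U| = (2 * 2 ^ \dim U)%N.
Proof.
move=> z1; have gU : group_set [set v | v \in U]%SET.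
  apply/group_setP; split => [|v w]; first by rewrite inE mem0v.
  by rewrite !inE; exact: rpredD.
have -> : preim_vspace U = (f @*^-1 Group gU)%g :> {set gT}.
  by apply/finset.setP => g; rewrite !inE.
rewrite card_morphpre ?imf ?finset.subsetT // kerf cards2 eq_sym z1.
congr (_ * _)%N; have := finfield.card_vspace U; rewrite card_Fp // => <-.
by apply: eq_card => v; rewrite inE.
Qed.

(** Since [z] is [(z * s) * s^-1], the subgroup [<<S>>] contains the kernel of [f]; by the spanning
    hypothesis it also maps onto [V]. *)
Lemma gen_of_span (S : {set gT}) :
  (forall g, g \in S -> (z * g)%g \in S) -> S != finset.set0 ->
  (<< [seq f g | g <- enum S] >>)%VS = fullv -> (<<S>> = [set: gT])%g.
Proof.
move=> Sz /finset.set0Pn[s sS] spanS.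
have zgen : (z \in <<S>>)%g.
  by rewrite -(mulgK s z) groupM ?groupV ?mem_gen ?Sz.
have onto v : exists2 g, (g \in <<S>>)%g & f g = v.
  have : v \in (<< [seq f g | g <- enum S] >>)%VS by rewrite spanS memvf.
  move/coord_span ->; elim/big_ind: _.
  - by exists 1%g; rewrite ?group1 // morph1.
  - by move=> _ _ [g gS <-] [h hS <-]; exists (g * h)%g; rewrite ?groupM ?morph_mulg_add.
  - move=> i _; set a := coord _ _ _; set w := _`_i.
    have /mapP[g gS ->] : w \in [seq f g | g <- enum S].
      by apply: mem_nth; rewrite ?size_tuple.
    rewrite mem_enum in gS.
    (* Over the field with two elements a linear combination is a plain sum, hence the image of a
       product of generators. *)
    have [->|->] : a = 0 \/ a = 1.
      by case: a => -[|[|//]] ?; [left|right]; apply/val_inj.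
      exists 1%g; rewrite ?group1 // morph1 scale0r //.
    by exists g; rewrite ?mem_gen // scale1r.
apply/eqP; rewrite finset.eqEsubset finset.subsetT; apply/fintype.subsetP => g _.
have [h hS fh] := onto (f g).
rewrite -(mulgKV h g) groupM //.
have : f (g * h^-1)%g == 0 by rewrite morph_mulg_add morph_invg_opp fh subrr.
by rewrite morph_eq0 !inE => /orP[]/eqP -> //; rewrite group1.
Qed.

Variables (k : nat) (T : {fset {vspace V}}).
Hypothesis spreadT : partial_spread k T.
Variables (S : {set gT}).
Hypothesis memS : forall g, (g \in S) = (f g \in points T).
Hypothesis z1 : z != 1%g.

(** The incidence count is applied to [f (g * h^-1)]. Pairs differing by the kernel are counted once
    per element of [T], and the negative term removes them; its factor 2 is the order of the
    kernel. *)
Lemma adjmx_partial_spread (K : numFieldType) :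
  adjmx K (cayley S) =
    - (2 * #|` T|)%:R *: avgmx K [set 1%g; z]%SET +
    \sum_(U <- T) (2 ^ k.+1)%:R *: avgmx K (preim_vspace U).
Proof.
have -> : \sum_(U <- T) (2 ^ k.+1)%:R *: avgmx K (preim_vspace U) =
    \sum_(U <- T) adjmx K (cayley (preim_vspace U)).
  apply: eq_big_seq => U UT; rewrite adjmx_avgmx; congr (_%:R *: _).
  by rewrite card_preim_vspace // spreadT.1 // expnS.
have -> : - (2 * #|` T|)%:R *: avgmx K [set 1%g; z]%SET =
    - #|` T|%:R *: adjmx K (cayley [set 1%g; z]%SET).
  rewrite scalerA cards2 eq_sym z1 natrM mulrC mulrN; congr (_ *: _).
  by rewrite mulKf // pnatr_eq0.
apply/matrixP => i j; rewrite mxE [in RHS]mxE summxE.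
under [in RHS]eq_bigr do rewrite mxE.
rewrite -natr_sum !mxE /cayley; set g := (_ * _)%g.
under [in RHS]eq_bigr do rewrite inE.
rewrite (partial_spread_count spreadT) -memS morph_eq0 natrD natrM mulNr.
by rewrite [in RHS]addrC addrK.
Qed.

Lemma preim_vspace_norm U : ([set: gT] \subset 'N(preim_vspace U))%g.
Proof.
apply/fintype.subsetP => h _; rewrite inE; apply/fintype.subsetP => g.
case/imsetP=> {}g gU ->; rewrite inE in gU.
by rewrite conjgE inE !morph_mulg_add morph_invg_opp addrC addrK.
Qed.

(** The two hypotheses give the exponential of the base term on the kernel and on the range of [E0].
    All shifts [j] are required by the induction that adds the remaining idempotents. *)
Lemma transition_partial_spread (K : numClosedFieldType) (t w : K) :
  (forall j : nat, scalar_exp ('i * t * ((2 ^ k.+1)%:R *+ j)) 1) ->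
  (forall j : nat,
     scalar_exp ('i * t * ((2 ^ k.+1)%:R *+ j - (2 * #|` T|)%:R)) w) ->
  transition (adjmx K (cayley S)) t *m evec K 1%g =
    ((w + 1) / 2) *: evec K 1%g + ((w - 1) / 2) *: evec K z.
Proof.
move=> h1 hw; set E0 := avgmx K [set 1%g; z]%SET.
have idE0 : E0 *m E0 = E0 by rewrite /E0 -kerf avgmx_idem.
have cE0 U : E0 *m avgmx K (preim_vspace U) = avgmx K (preim_vspace U) *m E0.
  exact: avgmx_comm (preim_vspace_norm U).
set L := w%:M *m E0 + 1%:M *m (1%:M - E0).
have -> : transition (adjmx K (cayley S)) t = L.
  apply: transitionE; rewrite adjmx_partial_spread.
  have := @cvg_exp_series_sum _ _ ('i * t) (2 ^ k.+1)%:R L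
    (- (2 * #|` T|)%:R *: E0) _ T (fun U => avgmx K (preim_vspace U)).
  move=> H; have {}H := H _ _ _ _ 0%N; rewrite mulr0n raddf0 addr0 in H; apply: H.
  - by move=> U; exact: avgmx_idem.
  - by move=> U W; exact: avgmx_comm (preim_vspace_norm W).
  - by move=> U; rewrite -scalemxAl cE0 scalemxAr.
  move=> j; rewrite addrC; apply: cvg_exp_series_shift => //.
  - exact: esym (scalar_mxC _ _).
  - by rewrite -raddfD /=; exact: exp_series_scalar.
  - exact: exp_series_scalar.
rewrite /L mulmxDl mul1mx mulmxBl mul1mx -mulmxA mul_scalar_mx avgmx_evec1 //.
rewrite !scalerDr opprD.
move: (evec K 1%g) (evec K z) => e1 e2.
have {2}-> : e1 = 2^-1 *: e1 + 2^-1 *: e1.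
  by rewrite -scalerDl [X in X *: _](_ : _ = 1) ?scale1r //; field.
rewrite !scalerA [(w + 1) / 2]mulrDl [(w - 1) / 2]mulrDl !scalerDl mul1r mulN1r scaleNr.
by rewrite [X in _ + X]addrA addrK addrACA.
Qed.

End VectorQuotient.

(** * Phases and the revival time *)

Section Phases.
Variable R : realType.
Local Open Scope complex_scope.

Lemma cos_odd_pihalf (a : nat) : odd a -> cos (a%:R * (pi / 2) : R) = 0.
Proof.
move=> oa; rewrite -[a]odd_double_half oa -muln2 natrD natrM.
rewrite -[(nat_of_bool true)%:R]/(1 : R).
elim: a./2 => [|b IH]; first by rewrite mul0r addr0 mul1r cos_pihalf.
rewrite -natr1 [X in cos X](_ : _ = (1 + b%:R * 2) * (pi / 2) + pi); last by field.
by rewrite cosDpi IH oppr0.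
Qed.

(** The phase is purely imaginary of modulus 1 and [s] is a sign, so the numerator has modulus
    [Num.sqrt 2]. *)
Lemma norm_half_unit (t s : R) : cos t = 0 -> s ^+ 2 = 1 ->
  `|(cos t +i* sin t + s%:C) / 2| = (Num.sqrt 2)^-1%:C.
Proof.
move=> ct s2; have := cos2Dsin2 t; rewrite ct expr0n add0r => st.
rewrite normrM normfV (ger0_norm (ler0n _ 2)) normc_def /= add0r addr0 s2 st.
have r2 : (Num.sqrt (2 : R)) ^+ 2 = 2 by rewrite sqr_sqrtr.
have r0 : Num.sqrt (2 : R) != 0 by rewrite sqrtr_eq0 -ltNge.
have -> : (2 : R[i]) = (2 : R)%:C by rewrite rmorph_nat.
rewrite -fmorph_div /=; congr (_%:C); rewrite -[1 + 1]/(2 : R) -[X in _ / X]r2.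
by field.
Qed.

End Phases.

Lemma balanced_revival_partial_spread (R : realType) (gT : finGroupType)
  (m k : nat) (z : gT) (f : {morphism [set: gT] >-> 'rV['F_2]_m})
  (T : {fset {vspace 'rV['F_2]_m}}) (S : {set gT}) :
  ('ker f = [set 1; z]%SET)%g -> (f @* [set: gT] = [set: 'rV['F_2]_m])%g ->
  partial_spread k T -> (forall g, (g \in S) = (f g \in points T)) -> z != 1%g ->
  (0 < #|` T|)%N -> (logn 2 #|` T| + 2 <= k)%N ->
  admits_balanced_revival R (cayley S).
Proof.
move=> kerf imf spreadT memS z1 N0 leNk.
set v := logn 2 #|` T| in leNk *.
have [a odda eN] : exists2 a, odd a & #|` T| = (a * 2 ^ v)%N.
  by have [a ? ?] := pfactor_coprime (isT : prime 2) N0; exists a; rewrite -?coprime2n.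
clearbody v.
(* Then [2 ^ k.+1 * tau] is [2 ^ (k - (v + 2))] full turns, by the bound on [v], while [2 * N * tau]
   is the odd multiple [a] of [pi / 2], where [N] is the size of [T]. *)
pose tau : R := pi / 2 ^+ (v + 2).
pose th : R := - (a%:R * (pi / 2)).
have cth : cos th = 0 by rewrite cosN cos_odd_pihalf.
pose w : R[i] := (cos th +i* sin th)%C.
have p2 (e : nat) : (2 ^+ e : R) != 0 by rewrite expf_neq0 // pnatr_eq0.
have tau1 : tau * (2 ^ k.+1)%:R = (pi *+ 2) *+ (2 ^ (k - (v + 2))).
  rewrite -{1}(subnKC leNk) -addnS natrX exprD exprS.
  by rewrite /tau mulrA divfK // -mulrnA -[RHS]mulr_natr natrM natrX.
have tauk (j : nat) : tau * ((2 ^ k.+1)%:R *+ j) = (pi *+ 2) *+ (2 ^ (k - (v + 2)) * j).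
  by rewrite mulrnA -tau1 mulrnAr.
have tauN : tau * (2 * #|` T|)%:R = - th.
  by rewrite eN !natrM natrX /tau /th exprD opprK; field; rewrite p2.
have nC (r : nat) : (r%:R : R[i]) = (r%:R)%:C%C by rewrite rmorph_nat.
have periodexp (y : R) (q : nat) :
  scalar_exp ('i * (y + (pi *+ 2) *+ q)%:C%C) (cos y +i* sin y)%C.
  have := @scalar_exp_i R (y + (pi *+ 2) *+ q).
  by rewrite (periodicn (@cosD2pi R)) (periodicn (@sinD2pi R)).
have e1 (j : nat) : scalar_exp ('i * tau%:C%C * ((2 ^ k.+1)%:R *+ j)) (1 : R[i]).
  rewrite nC -rmorphMn -mulrA -rmorphM /= tauk -[X in X%:C%C]add0r.
  have := periodexp 0 (2 ^ (k - (v + 2)) * j)%N.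
  by rewrite cos0 sin0.
have ew (j : nat) :
   scalar_exp ('i * tau%:C%C * ((2 ^ k.+1)%:R *+ j - (2 * #|` T|)%:R)) w.
  rewrite !nC -rmorphMn -rmorphB -mulrA -rmorphM /= mulrBr tauk tauN opprK addrC.
  exact: periodexp.
have nb : `|(w - 1) / 2| = (Num.sqrt 2)^-1%:C%C.
  by rewrite -(@norm_half_unit _ th (-1)) ?sqrrN ?expr1n // rmorphN1.
have na : `|(w + 1) / 2| = (Num.sqrt 2)^-1%:C%C.
  by rewrite -(@norm_half_unit _ th 1) ?expr1n // rmorph1.
exists tau, 1%g, z, ((w + 1) / 2), ((w - 1) / 2); split => //.
  by rewrite divr_gt0 ?pi_gt0 // exprn_gt0.
split.
- by rewrite eq_sym.
- rewrite na nb -rmorphXn /= exprVn sqr_sqrtr // -rmorphD /=.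
  by rewrite -[X in X + X]mul1r -splitr.
- by rewrite -normr_eq0 nb fmorph_eq0 invr_eq0 sqrtr_eq0 -ltNge ltr0n.
- exact: transition_partial_spread kerf imf _ _ spreadT _ memS z1 _ _ _ e1 ew.
Qed.

(** * Spanning, conjugacy classes and the extraspecial group *)

Lemma span_partial_spread (n : nat) (T : {fset {vspace 'rV['F_2]_(2 * n)}}) :
  partial_spread n T -> (1 < #|` T|)%N -> (<< enum (points T) >>)%VS = fullv.
Proof.
move=> [dimT disjT] T2.
(* Two elements suffice: of dimension [n] and meeting in zero, they sum to the whole space. *)
have [U [W [UT WT UW]]] : exists U W, [/\ U \in T, W \in T & U != W].
  have [U UT] : exists U, U \in T by apply/fset0Pn; rewrite -cardfs_gt0 ltnW.
  have : (0 < #|` (T `\ U)%fset|)%N by rewrite (cardfsD1 U T) UT in T2.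
  rewrite cardfs_gt0 => /fset0Pn[W]; rewrite !inE => /andP[WU WT].
  by exists U, W; rewrite eq_sym.
have sub (X : {vspace 'rV['F_2]_(2 * n)}) : X \in T -> (X <= << enum (points T) >>)%VS.
  move=> XT; apply/subvP => v vX.
  have [->|v0] := eqVneq v 0; first exact: mem0v.
  by apply: memv_span; rewrite mem_enum inE v0; apply/hasP; exists X.
apply/eqP; rewrite eqEdim subvf /=.
apply: (@leq_trans (\dim (U + W)%VS)); last by apply: dimvS; rewrite subv_add !sub.
have := dimv_sum_cap U W; rewrite (disjT _ _ UT WT UW) dimv0 addn0 => ->.
by rewrite (dimT _ UT) (dimT _ WT) dimvf /dim /= mul1n mul2n addnn.
Qed.

(** Some commutator of the noncentral [s] is nontrivial; it lies in the derived subgroup, which is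
    the center, so it is [z]. Classes are thus closed under multiplication by [z]. *)
Lemma extraspecial_class_mul (gT : finGroupType) (z : gT) :
  extraspecial [set: gT]%G ->
  ('Z([set: gT]) = [set 1; z]%SET)%g ->
  forall s, s \notin 'Z([set: gT])%g -> (z * s)%g \in (s ^: [set: gT])%g.
Proof.
move=> [[_ derG] _] eZ s sZ.
have [b sb] : exists b, [~ s, b]%g != 1%g.
  apply/existsP; apply: contraR sZ; rewrite negb_exists => /forallP cs.
  apply/centerP; split => [|b _]; first by rewrite inE.
  by apply/commgP; have := cs b; rewrite negbK.
have : [~ s, b]%g \in 'Z([set: gT])%g by rewrite -derG mem_commg ?inE.
rewrite eZ !inE (negPf sb) /= => /eqP sbz.
have <- : (s ^ b = z * s)%g.
  have zZ : z \in 'Z([set: gT])%g by rewrite eZ !inE eqxx orbT.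
  by case/centerP: zZ => _ cz; rewrite cz ?inE // -sbz commgEl mulKVg.
by rewrite memJ_class ?inE.
Qed.

Theorem theorem5p2 (R : realType) (gT : finGroupType) (n k l N : nat)
  (hG : (2.-group [set: gT])%g)
  (hE : extraspecial [set: gT]%G)
  (hcard : #|[set: gT]%G| = (2 ^ (2 * n + 1))%N)
  (z : gT) (hz : 'Z([set: gT])%g = [set 1%g; z]%SET)
  (phi : {morphism ([set: gT]%G / 'Z([set: gT]))%g >-> 'rV['F_2]_(2 * n)})
  (hphi : isom ([set: gT]%G / 'Z([set: gT]))%g [set: 'rV['F_2]_(2 * n)]%G phi)
  (T : {fset {vspace 'rV['F_2]_(2 * n)}})
  (hT : partial_spread k T)
  (hN : #|` T| = N)
  (x : 'I_l -> gT)
  (hx : forall i, x i \notin 'Z([set: gT])%g)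
  (hdistinct : injective (fun i => (x i ^: [set: gT])%g))
  (S : {set gT})
  (hS : S = \bigcup_(i < l) (x i ^: [set: gT])%g)
  (hSbar : [set phi (coset 'Z([set: gT])%g g) | g in S]%SET = points T) :
  ( (<< enum (points T) >>)%VS = fullv ->
    (logn 2 N + 2 <= k)%N ->
    connected_graph (cayley S) /\ admits_balanced_revival R (cayley S) ) /\
  ( k = n -> (3 <= n)%N -> N = (2 ^ (n - 2))%N ->
    connected_graph (cayley S) /\ admits_balanced_revival R (cayley S) ).
Proof.
have [cZ [m [m0 isoZ]]] := (extraspecial_2groupE hG).1 hE.
have z1 : z != 1%g.
  by apply/eqP => ez; move: cZ; rewrite hz ez finset.setUid cards1.
(* The order is also [2 ^ m.+1] with [m] positive, so it cannot be 2. *)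
have n0 : (0 < n)%N.
  rewrite lt0n; apply/eqP => en; move: (card_isog isoZ) hcard.
  rewrite card_quotient ?normal_norm ?center_normal //.
  rewrite -(Lagrange (center_sub [set: gT]%G)) => ->.
  rewrite cZ en cardsT card_mx mul1n card_Fp // -expnS => /eqP.
  by rewrite eqn_exp2l // -(prednK m0).
have nZ : ([set: gT] \subset 'N('Z([set: gT])))%g by rewrite normal_norm ?center_normal.
have inN (g : gT) : g \in 'N('Z([set: gT]))%g by rewrite (fintype.subsetP nZ) ?inE.
have inQ (g : gT) : coset 'Z([set: gT])%g g \in ([set: gT] / 'Z([set: gT]))%g.
  by rewrite mem_quotient ?inE.
have f0M : {in [set: gT]%SET &, {morph (fun g => phi (coset 'Z([set: gT])%g g)) :
    g h / (g * h)%g >-> (g * h)%g}}.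
  by move=> g h _ _ /=; rewrite coset_morphM ?inN // (morphM phi) ?inQ.
pose f := Morphism f0M.
have [injphi imphi] := isomP hphi.
have kerf : ('ker f = [set 1; z]%SET)%g.
  rewrite -hz; apply/finset.setP => g.
  apply/(kerP f (finset.in_setT g))/idP => [fg|gZ].
    apply: coset_idr (inN g) _; apply: (injmP injphi) => //.
    exact: etrans fg (esym (morph1 phi)).
  by rewrite /= coset_id //; exact: (morph1 phi).
have imf : (f @* [set: gT] = [set: 'rV['F_2]_(2 * n)])%g.
  apply/finset.setP => v; rewrite [RHS]inE.
  have : v \in [set: 'rV['F_2]_(2 * n)]%SET by rewrite inE.
  rewrite -imphi => /morphimP[q _ /morphimP[g _ _ ->] ->].
  by apply/morphimP; exists g; rewrite ?inE.
have zS g : g \in S -> (z * g)%g \in S.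
  rewrite hS => /bigcupP[i _ gi]; apply/bigcupP; exists i => //.
  have <- : (g ^: [set: gT] = x i ^: [set: gT])%g by apply/class_eqP.
  apply: extraspecial_class_mul => //.
  by have /imsetP[h _ ->] := gi; rewrite memJ_norm ?inN.
(* The fibers of [f] are the pairs [s], [z * s], and [S] is closed under [z], so it is the full
   preimage of its image. *)
have memS g : (g \in S) = (f g \in points T).
  rewrite -hSbar; apply/idP/imsetP => [gS|[s sS fgs]]; first by exists g.
  have : f (g * s^-1)%g == 0 by rewrite morph_mulg_add morph_invg_opp fgs /= subrr.
  rewrite (morph_eq0 kerf) !inE => fgs1; rewrite -(mulgKV s g).
  case/orP: fgs1 => /eqP ->; last exact: zS.
  by rewrite mul1g.
have main : (<< enum (points T) >>)%VS = fullv -> (logn 2 N + 2 <= k)%N ->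
    connected_graph (cayley S) /\ admits_balanced_revival R (cayley S).
  move=> spanT leNk.
  (* A spanning set of a nonzero space contains a point. It yields both a member of [S] and an
     element of [T], which rules out the default value [logn 2 0 = 0]. *)
  have [v vT] : exists v, v \in points T.
    apply/finset.set0Pn; apply/eqP => T0; move: spanT.
    rewrite T0 enum_set0 span_nil => /(congr1 (fun X => \dim X)).
    rewrite dimv0 dimvf /dim /= mul1n => /esym/eqP.
    by rewrite muln_eq0 -(prednK n0).
  split.
    apply/connected_cayley/(gen_of_span kerf zS).
      apply/finset.set0Pn; have [g fg] := morph_onto imf v.
      by exists g; rewrite memS fg.
    apply/eqP; rewrite eqEsubv subvf -spanT; apply: sub_span => w.
    rewrite mem_enum -hSbar => /imsetP[g gS ->].
    by apply/mapP; exists g; rewrite ?mem_enum.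
  apply: balanced_revival_partial_spread kerf imf hT memS z1 _ _; last by rewrite hN.
  move: vT; rewrite inE => /andP[_ /hasP[U UT _]].
  by rewrite cardfs_gt0; apply/fset0Pn; exists U.
(* From [n >= 3] there are at least two elements, so the points span; the valuation is [n - 2] and
   the bound is attained with equality. *)
split=> // kn n3 eN; apply: main.
  rewrite kn in hT; apply: span_partial_spread hT _.
  by rewrite hN eN -(expn0 2) ltn_exp2l // subn_gt0.
by rewrite eN pfactorK // kn subnK // ltnW.
Qed.
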